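(* Let $m>0$ and $c>0$. For a rapidity $\phi\in\mathbb{R}$ let $v_{\mathrm{SR}}:=c\tanh\phi$ and $K_m(\phi):=m[\cosh(\phi)-1]$. (i) For all $\phi\in\mathbb{R}$, $K_m(\phi)=m[\cosh(\phi)-1]=m(\gamma_L-1)$, where $\gamma_L:=\cosh\phi=1/\sqrt{1-(v_{\mathrm{SR}}/c)^2}$ is the Lorentz factor associated with $v_{\mathrm{SR}}/c=\tanh\phi$. (ii) As $\phi\to 0$, $K_m(\phi)=\tfrac12 m\phi^2+\tfrac{m}{24}\phi^4+O(\phi^6)$. In natural units ($c=1$), with coordinate velocity $\dot q=\phi$ and with $\phi=v_{\mathrm{SR}}+v_{\mathrm{SR}}^3/3+O(v_{\mathrm{SR}}^5)$, this gives $$K_m=\tfrac12 m\,\dot q^2+\tfrac{m}{24}\dot q^4+O(\dot q^6)=\tfrac12 m\,v_{\mathrm{SR}}^2+O(v_{\mathrm{SR}}^4),$$ so that the two readings in terms of $\dot q$ and of $v_{\mathrm{SR}}$ coincide at quadratic order and differ only at fourth order.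
   Context: Kinematic identification: for a positive degree of freedom $\gamma$ with $\xi=\log\gamma$, and in natural units ($c=1$ and reference time scale $1$), the mechanical position is $q:=\xi$ and the boost rapidity is $\phi:=\dot\xi$, so $\dot q=\phi$ exactly; the special-relativistic velocity is $v_{\mathrm{SR}}=c\tanh\phi$. $K_m$ is the physical kinetic cost in natural units (in standard units it carries an extra factor $c^2$). *)

(* Defs.v *)
From Stdlib Require Import Reals.
From Coquelicot Require Import Coquelicot.
Open Scope R_scope.

Definition v_SR (c phi : R) : R := c * tanh phi.

Definition K (m phi : R) : R := m * (cosh phi - 1).

Definition lorentz_factor (beta : R) : R := 1 / sqrt (1 - beta ^ 2).

(* f = O(g) along F; Coquelicot only provides the little-o [is_domin]. *)
Definition is_bigO {T : Type} (F : (T -> Prop) -> Prop) (f g : T -> R) : Prop :=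
  exists C : R, F (fun s => Rabs (f s) <= C * Rabs (g s)).

Definition is_bigTheta {T : Type} (F : (T -> Prop) -> Prop) (f g : T -> R) : Prop :=
  is_bigO F f g /\ is_bigO F g f.

(* The filter "as x s -> 0" on T, generated by the preimages under x of the
   neighbourhoods of 0. Estimates along it are uniform over all s such that
   x s is small. *)
Definition to0 {T : Type} (x : T -> R) : (T -> Prop) -> Prop :=
  fun P => locally 0 (fun y => forall s, x s = y -> P s).

Record dof := Dof {
  gamma :> R -> R;
  gamma_pos : forall t, 0 < gamma t;
  gamma_diff : forall t, ex_derive gamma t }.

Definition xi (g : dof) (t : R) : R := ln (g t).

Definition position (g : dof) : R -> R := xi g.

(* A degree of freedom observed at a time; the time unit is the reference
   time scale, so no scale factor enters the derivatives below. *)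
Definition state : Type := (dof * R)%type.

Definition rapidity (s : state) : R := Derive (xi (fst s)) (snd s).

Definition qdot (s : state) : R := Derive (position (fst s)) (snd s).

(* Natural units: c = 1. *)
Definition v_nat (s : state) : R := v_SR 1 (rapidity s).

Definition K_nat (m : R) (s : state) : R := K m (rapidity s).

(* Main.v *)
(* Everything reduces to the rapidity p and t = tanh p. The Taylor bound for cosh
   follows by integrating [cosh <= 3] six times. Since (p - t - t^3/3)' = t^4 and
   t' = 1 - t^2, the mean value theorem gives t = p j and p - t - t^3/3 = p k with
   j close to 1 and 0 <= k <= t^4, from which all comparisons of p with t follow.
   Finally cosh p = (1 - t^2)^(-1/2), and the expansion 1 + u/2 + 3u^2/8 + O(u^3)
   at u = t^2 is checked by squaring; its quartic coefficient is 3/8, not 1/24. *)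

Require Import Defs.
From Stdlib Require Import Reals Lra.
From Coquelicot Require Import Coquelicot.
Open Scope R_scope.

(** * Big-O estimates from explicit radii *)

Lemma to0_intro {T : Type} (x : T -> R) (P : T -> Prop) (d : R) :
  0 < d -> (forall s, Rabs (x s) < d -> P s) -> to0 x P.
Proof.
  intros Hd H. exists (mkposreal d Hd). intros y Hy s <-. apply H.
  change (Rabs (x s - 0) < d) in Hy. now rewrite Rminus_0_r in Hy.
Qed.

Lemma bigO_to0 {T : Type} (x f g : T -> R) (C d : R) :
  0 < d -> (forall s, Rabs (x s) < d -> Rabs (f s) <= C * Rabs (g s)) ->
  is_bigO (to0 x) f g.
Proof. intros Hd H. exists C. now apply to0_intro with d. Qed.

Lemma Rabs_pow4 (x : R) : Rabs (x ^ 4) = x ^ 4.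
Proof. apply Rabs_pos_eq. replace (x ^ 4) with ((x * x) * (x * x)) by ring. apply Rle_0_sqr. Qed.

Lemma Rabs_pow6 (x : R) : Rabs (x ^ 6) = x ^ 6.
Proof. apply Rabs_pos_eq. replace (x ^ 6) with ((x ^ 3) * (x ^ 3)) by ring. apply Rle_0_sqr. Qed.

(** * Hyperbolic functions and the Lorentz factor *)

Lemma cosh_pos (x : R) : 0 < cosh x.
Proof. unfold cosh. generalize (exp_pos x) (exp_pos (- x)). lra. Qed.

Lemma cosh2_sinh2 (x : R) : cosh x ^ 2 - sinh x ^ 2 = 1.
Proof.
  unfold cosh, sinh. generalize (exp_pos x); intro. rewrite exp_Ropp. field. lra.
Qed.

Lemma is_derive_cosh (x : R) : is_derive cosh x (sinh x).
Proof. apply is_derive_Reals, derivable_pt_lim_cosh. Qed.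

Lemma is_derive_sinh (x : R) : is_derive sinh x (cosh x).
Proof. apply is_derive_Reals, derivable_pt_lim_sinh. Qed.

Lemma is_derive_tanh (x : R) : is_derive tanh x (1 - tanh x ^ 2).
Proof.
  generalize (cosh_pos x); intro H.
  replace (1 - tanh x ^ 2) with ((cosh x * cosh x - sinh x * sinh x) / cosh x ^ 2)
    by (unfold tanh; field; lra).
  apply (is_derive_div sinh cosh x (cosh x) (sinh x)).
  - apply is_derive_sinh.
  - apply is_derive_cosh.
  - lra.
Qed.

Lemma cosh2_tanh2 (x : R) : cosh x ^ 2 * (1 - tanh x ^ 2) = 1.
Proof.
  rewrite <- (cosh2_sinh2 x) at 2. unfold tanh. field.
  generalize (cosh_pos x); lra.
Qed.

Lemma tanh2_lt_1 (x : R) : 0 < 1 - tanh x ^ 2.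
Proof.
  generalize (cosh2_tanh2 x) (pow_lt _ 2 (cosh_pos x)); intros. nra.
Qed.

Lemma cosh_lorentz_factor (x : R) : cosh x = lorentz_factor (tanh x).
Proof.
  unfold lorentz_factor. generalize (tanh2_lt_1 x) (cosh_pos x) (cosh2_tanh2 x); intros H1 H2 H3.
  replace (1 - tanh x ^ 2) with ((/ cosh x) ^ 2).
  - rewrite sqrt_pow2.
    + field. lra.
    + left. now apply Rinv_0_lt_compat.
  - apply Rmult_eq_reg_l with (cosh x ^ 2); [rewrite H3; field; lra|].
    generalize (pow_lt _ 2 H2); lra.
Qed.

(** * Repeated integration and the Taylor bound for [cosh] *)

Lemma mean_value_at_0 (f df : R -> R) (x : R) :
  (forall y, is_derive f y (df y)) -> f 0 = 0 ->
  exists z, Rabs z <= Rabs x /\ f x = x * df z.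
Proof.
  intros Hd H0.
  destruct (MVT_gen f 0 x df) as [z [Hz E]].
  - auto.
  - intros y _. apply continuity_pt_filterlim, (ex_derive_continuous f). now exists (df y).
  - exists z. split.
    + unfold Rmin, Rmax in Hz. destruct (Rle_dec 0 x); unfold Rabs;
      destruct (Rcase_abs z), (Rcase_abs x); lra.
    + rewrite H0 in E. lra.
Qed.

(** The mean value form [f x = x * df z] supplies the extra factor [x]. The constant is carried
    along rather than divided by [S n], which is enough for big-O. *)
Lemma bound_integrate (f df : R -> R) (C : R) (n : nat) :
  (forall y, is_derive f y (df y)) -> f 0 = 0 ->
  (forall y, Rabs y <= 1 -> Rabs (df y) <= C * Rabs y ^ n) ->
  forall x, Rabs x <= 1 -> Rabs (f x) <= C * Rabs x ^ S n.
Proof.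
  intros Hd H0 Hb x Hx.
  destruct (mean_value_at_0 f df x Hd H0) as [z [Hz ->]].
  (* The sign of [C] comes from the bound at 1, where it dominates an absolute value. *)
  assert (HC : 0 <= C).
  { generalize (Hb 1) (Rabs_pos (df 1)). rewrite Rabs_R1, pow1. intros H H'.
    specialize (H (Rle_refl 1)). lra. }
  rewrite Rabs_mult. simpl.
  replace (C * (Rabs x * Rabs x ^ n)) with (Rabs x * (C * Rabs x ^ n)) by ring.
  apply Rmult_le_compat_l; [apply Rabs_pos|].
  apply Rle_trans with (C * Rabs z ^ n); [apply Hb; lra|].
  apply Rmult_le_compat_l; [exact HC|].
  apply pow_incr. split; [apply Rabs_pos|exact Hz].
Qed.

Lemma cosh_le_3 (x : R) : Rabs x <= 1 -> cosh x <= 3.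
Proof.
  intros H. apply Rabs_le_between in H. unfold cosh.
  assert (E : forall y, y <= 1 -> exp y <= 3).
  { intros y Hy. apply Rle_trans with (exp 1); [|apply exp_le_3].
    destruct Hy as [Hy | ->]; [left; now apply exp_increasing | right; reflexivity]. }
  generalize (E x) (E (- x)). lra.
Qed.

Lemma cosh_taylor4 (x : R) : Rabs x <= 1 ->
  Rabs (cosh x - 1 - x ^ 2 / 2 - x ^ 4 / 24) <= 3 * Rabs x ^ 6.
Proof.
  revert x.
  (* Each remainder differentiates into the next, down to [cosh] itself, bounded by 3. Read upwards,
     the exponent climbs from 0 to 6. *)
  apply (bound_integrate _ (fun x => sinh x - x - x ^ 3 / 6) 3 5);
    [intro y; auto_derive; [easy|simpl; field]|rewrite cosh_0; field|].
  apply (bound_integrate _ (fun x => cosh x - 1 - x ^ 2 / 2) 3 4);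
    [intro y; auto_derive; [easy|simpl; field]|rewrite sinh_0; field|].
  apply (bound_integrate _ (fun x => sinh x - x) 3 3);
    [intro y; auto_derive; [easy|simpl; field]|rewrite cosh_0; field|].
  apply (bound_integrate _ (fun x => cosh x - 1) 3 2);
    [intro y; auto_derive; [easy|simpl; ring]|rewrite sinh_0; field|].
  apply (bound_integrate _ sinh 3 1);
    [intro y; auto_derive; [easy|simpl; ring]|rewrite cosh_0; field|].
  apply (bound_integrate _ cosh 3 0);
    [exact is_derive_sinh|exact sinh_0|].
  intros y Hy. rewrite Rabs_pos_eq by (left; apply cosh_pos).
  simpl. rewrite Rmult_1_r. now apply cosh_le_3.
Qed.

Lemma K_taylor4 (m x : R) : 0 < m -> Rabs x <= 1 ->
  Rabs (K m x - (1 / 2 * m * x ^ 2 + m / 24 * x ^ 4)) <= (3 * m) * Rabs (x ^ 6).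
Proof.
  intros Hm Hx. unfold K.
  replace (m * (cosh x - 1) - (1 / 2 * m * x ^ 2 + m / 24 * x ^ 4))
    with (m * (cosh x - 1 - x ^ 2 / 2 - x ^ 4 / 24)) by field.
  rewrite Rabs_mult, (Rabs_pos_eq m), <- RPow_abs by lra.
  generalize (Rmult_le_compat_l m _ _ (Rlt_le _ _ Hm) (cosh_taylor4 x Hx)). lra.
Qed.

(** * Comparison of the rapidity with its [tanh] *)

Lemma tanh_0 : tanh 0 = 0.
Proof. unfold tanh. rewrite sinh_0. unfold Rdiv. apply Rmult_0_l. Qed.

Lemma tanh_le_id (x : R) : Rabs (tanh x) <= Rabs x.
Proof.
  destruct (mean_value_at_0 tanh _ x is_derive_tanh tanh_0) as [z [_ ->]].
  generalize (tanh2_lt_1 z) (pow2_ge_0 (tanh z)) (Rabs_pos x); intros.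
  rewrite Rabs_mult, (Rabs_pos_eq (1 - _)) by lra. nra.
Qed.

Lemma tanh_incr (x y : R) : x <= y -> tanh x <= tanh y.
Proof.
  intros Hxy.
  destruct (MVT_gen tanh x y (fun z => 1 - tanh z ^ 2)) as [z [_ E]].
  - intros; apply is_derive_tanh.
  - intros z _. apply continuity_pt_filterlim, (ex_derive_continuous tanh).
    exists (1 - tanh z ^ 2). apply is_derive_tanh.
  - generalize (tanh2_lt_1 z). nra.
Qed.

Lemma tanh_opp (x : R) : tanh (- x) = - tanh x.
Proof.
  unfold tanh, sinh, cosh. rewrite Ropp_involutive.
  field. generalize (exp_pos x) (exp_pos (- x)). lra.
Qed.

(** Oddness reduces the sign cases. With [tanh_incr] this makes [Rabs (tanh z)] increasing in
    [Rabs z], so bounds at mean value points pass to the endpoint. *)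
Lemma tanh_Rabs (x : R) : Rabs (tanh x) = tanh (Rabs x).
Proof.
  unfold Rabs at 2. destruct (Rcase_abs x) as [H|H].
  - rewrite tanh_opp. apply Rabs_left1. rewrite <- tanh_0. apply tanh_incr. lra.
  - apply Rabs_pos_eq. rewrite <- tanh_0. apply tanh_incr. lra.
Qed.

Lemma rapidity_vs_tanh (p : R) : Rabs (tanh p) < 1 / 2 ->
  exists j k, 3 / 4 <= j <= 1 /\ 0 <= k <= tanh p ^ 4 /\
    tanh p = p * j /\ p - (tanh p + tanh p ^ 3 / 3) = p * k.
Proof.
  intros Hp.
  assert (B : forall z, Rabs z <= Rabs p -> Rabs (tanh z) <= Rabs (tanh p)).
  { intros z Hz. rewrite !tanh_Rabs. now apply tanh_incr. }
  destruct (mean_value_at_0 tanh _ p is_derive_tanh tanh_0) as [z [Hz Ez]].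
  destruct (mean_value_at_0 (fun y => y - (tanh y + tanh y ^ 3 / 3))
              (fun y => tanh y ^ 4) p) as [w [Hw Ew]].
  - intro y. change R in y. auto_derive.
    + repeat split; exists (1 - tanh y ^ 2); apply is_derive_tanh.
    + rewrite (is_derive_unique (fun x : R => tanh x) y _ (is_derive_tanh y)). field.
  - rewrite tanh_0. field.
  (* The two derivatives at their mean value points; the lower bound 3/4 is 1 - (1/2)^2. *)
  - exists (1 - tanh z ^ 2), (tanh w ^ 4).
    repeat split; try assumption.
    + generalize (B z Hz). rewrite <- (pow2_abs (tanh z)). generalize (Rabs_pos (tanh z)). nra.
    + generalize (pow2_ge_0 (tanh z)). lra.
    + rewrite <- Rabs_pow4. apply Rabs_pos.
    + rewrite <- (Rabs_pow4 (tanh w)), <- (Rabs_pow4 (tanh p)), <- !RPow_abs.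
      apply pow_incr. split; [apply Rabs_pos|auto].
Qed.

(** The remainder is [p * k] with [k <= tanh p ^ 4], and [j >= 3 / 4] bounds [Rabs p] by 4/3 of
    [Rabs (tanh p)]. *)
Lemma rapidity_expansion (p : R) : Rabs (tanh p) < 1 / 2 ->
  Rabs (p - (tanh p + tanh p ^ 3 / 3)) <= 4 / 3 * Rabs (tanh p ^ 5).
Proof.
  intros Hp. destruct (rapidity_vs_tanh p Hp) as (j & k & Hj & Hk & Ej & ->).
  assert (H : Rabs p <= 4 / 3 * Rabs (tanh p)).
  { rewrite Ej, Rabs_mult, (Rabs_pos_eq j) by lra. generalize (Rabs_pos p). nra. }
  replace (tanh p ^ 5) with (tanh p * tanh p ^ 4) by ring.
  rewrite !Rabs_mult, Rabs_pow4, (Rabs_pos_eq k), <- Rmult_assoc by lra.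
  apply Rmult_le_compat; try apply Rabs_pos; lra.
Qed.

(** Factor the gap as (p - t)(p + t) with t = tanh p: the first factor is p k + t^3/3 and the second
    is p (1 + j). Substituting t = p j leaves p^2 times a quantity comparable to p^2. *)
Lemma square_gap_bounds (p : R) : Rabs p < 1 / 2 ->
  9 / 64 * p ^ 4 <= p ^ 2 - tanh p ^ 2 <= 2 * p ^ 4.
Proof.
  intros Hp. generalize (tanh_le_id p); intro Hle.
  destruct (rapidity_vs_tanh p ltac:(lra)) as (j & k & Hj & Hk & Ej & E).
  assert (Hj3 : 27 / 64 <= j ^ 3 <= 1) by (split; nra).
  assert (Hp2 : 0 <= p ^ 2 <= 1 / 4).
  { rewrite <- pow2_abs. generalize (Rabs_pos p). split; nra. }
  assert (Hj4 : 0 <= j ^ 4 <= 1) by (simpl in *; split; nra).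
  assert (Hk' : k <= p ^ 2 * (1 / 4)).
  { apply Rle_trans with (1 := proj2 Hk). rewrite Ej.
    replace ((p * j) ^ 4) with (p ^ 2 * (p ^ 2 * j ^ 4)) by ring.
    apply Rmult_le_compat_l; nra. }
  replace (p ^ 2 - tanh p ^ 2) with (p ^ 2 * ((k + j ^ 3 * p ^ 2 / 3) * (1 + j))).
  2:{ transitivity ((p * k + tanh p ^ 3 / 3) * (p + tanh p)).
      - rewrite Ej. field.
      - rewrite <- E. field. }
  replace (p ^ 4) with (p ^ 2 * p ^ 2) by ring.
  (* Below, [k >= 0] and j^3/3 >= 9/64; above, 1/4 + 1/3 <= 1. The factor [1 + j] lies between 1 and
     2. *)
  assert (A : 9 / 64 * p ^ 2 <= k + j ^ 3 * p ^ 2 / 3 <= p ^ 2) by (split; nra).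
  split.
  - replace (9 / 64 * (p ^ 2 * p ^ 2)) with (p ^ 2 * (9 / 64 * p ^ 2)) by ring.
    apply Rmult_le_compat_l; nra.
  - replace (2 * (p ^ 2 * p ^ 2)) with (p ^ 2 * (2 * p ^ 2)) by ring.
    apply Rmult_le_compat_l; nra.
Qed.

(** * Expansion of the Lorentz factor and of [K] in the velocity *)

Lemma inv_sqrt_expansion (g u : R) : 0 < g -> 0 <= u <= 1 / 4 -> g ^ 2 * (1 - u) = 1 ->
  0 <= g - (1 + u / 2 + 3 / 8 * u ^ 2) <= u ^ 3.
Proof.
  intros Hg Hu E.
  assert (Hu2 : 0 <= u ^ 2) by apply pow2_ge_0.
  assert (Hu3 : 0 <= u ^ 3) by (apply pow_le; lra).
  assert (Hu4 : 0 <= u ^ 4) by (apply pow_le; lra).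
  assert (Hu5 : 0 <= u ^ 5) by (apply pow_le; lra).
  assert (Hu6 : 0 <= u ^ 6) by (apply pow_le; lra).
  (* Positive numbers are compared through their squares times [1 - u], a quantity equal to 1 for
     [g]. *)
  assert (C : forall a b, 0 <= a -> 0 < b -> a ^ 2 * (1 - u) <= b ^ 2 * (1 - u) -> a <= b).
  { intros a b Ha Hb H. apply Rmult_le_reg_r in H; [|lra]. nra. }
  set (q := 1 + u / 2 + 3 / 8 * u ^ 2).
  assert (Eq : q ^ 2 * (1 - u) = 1 - 5 / 8 * u ^ 3 - 15 / 64 * u ^ 4 - 9 / 64 * u ^ 5)
    by (unfold q; field).
  assert (Hq : 1 <= q) by (unfold q; lra).
  split.
  - assert (q <= g) by (apply C; lra). lra.
  - assert (g <= q + u ^ 3); [|lra].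
    apply C; try lra.
    replace ((q + u ^ 3) ^ 2 * (1 - u))
      with (q ^ 2 * (1 - u) + u ^ 3 * ((2 * q + u ^ 3) * (1 - u))) by ring.
    (* Adding [u ^ 3] to [q] thus gains at least [u ^ 3], more than the deficit in [Eq], whose
       higher powers are absorbed using [u <= 1 / 4]. *)
    assert (1 <= (2 * q + u ^ 3) * (1 - u)) by nra.
    assert (u ^ 3 * 1 <= u ^ 3 * ((2 * q + u ^ 3) * (1 - u))) by (apply Rmult_le_compat_l; lra).
    assert (u ^ 4 <= u ^ 3 / 4) by (replace (u ^ 4) with (u ^ 3 * u) by ring; nra).
    assert (u ^ 5 <= u ^ 4 / 4) by (replace (u ^ 5) with (u ^ 4 * u) by ring; nra).
    lra.
Qed.

Lemma K_velocity_expansion (m p : R) : 0 < m -> Rabs (tanh p) < 1 / 2 ->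
  0 <= K m p - (1 / 2 * m * tanh p ^ 2 + 3 / 8 * m * tanh p ^ 4) <= m * tanh p ^ 6.
Proof.
  intros Hm Hp.
  assert (Hu : 0 <= tanh p ^ 2 <= 1 / 4).
  { rewrite <- pow2_abs. generalize (Rabs_pos (tanh p)). split; nra. }
  destruct (inv_sqrt_expansion _ _ (cosh_pos p) Hu (cosh2_tanh2 p)) as [H1 H2].
  replace (K m p - (1 / 2 * m * tanh p ^ 2 + 3 / 8 * m * tanh p ^ 4))
    with (m * (cosh p - (1 + tanh p ^ 2 / 2 + 3 / 8 * (tanh p ^ 2) ^ 2)))
    by (unfold K; field).
  replace (tanh p ^ 6) with ((tanh p ^ 2) ^ 3) by ring.
  split; [apply Rmult_le_pos|apply Rmult_le_compat_l]; lra.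
Qed.

(** [Derive] is total, so differentiability must be proved separately; positivity of [gamma] keeps
    [ln] differentiable. *)
Lemma is_derive_xi (g : dof) (t : R) : is_derive (xi g) t (Derive (xi g) t).
Proof.
  apply Derive_correct. unfold xi. auto_derive.
  split; [apply gamma_diff|split; [apply gamma_pos|easy]].
Qed.

Lemma v_natE (s : state) : v_nat s = tanh (rapidity s).
Proof. apply Rmult_1_l. Qed.

Theorem proposition6p5 (m c : R) (hm : 0 < m) (hc : 0 < c) :
  (* (i) *)
  (forall phi : R,
     v_SR c phi / c = tanh phi /\
     0 < 1 - (v_SR c phi / c) ^ 2 /\
     cosh phi = lorentz_factor (v_SR c phi / c) /\
     K m phi = m * (cosh phi - 1) /\
     K m phi = m * (lorentz_factor (v_SR c phi / c) - 1))
  /\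
  (* (ii), as phi -> 0 *)
  is_bigO (locally 0)
    (fun phi => K m phi - (1 / 2 * m * phi ^ 2 + m / 24 * phi ^ 4))
    (fun phi => phi ^ 6)
  /\
  (* (ii), natural units *)
  (forall s : state,
     is_derive (position (fst s)) (snd s) (qdot s) /\ qdot s = rapidity s)
  /\
  is_bigO (to0 v_nat)
    (fun s => rapidity s - (v_nat s + v_nat s ^ 3 / 3))
    (fun s => v_nat s ^ 5)
  /\
  is_bigO (to0 qdot)
    (fun s => K_nat m s - (1 / 2 * m * qdot s ^ 2 + m / 24 * qdot s ^ 4))
    (fun s => qdot s ^ 6)
  /\
  is_bigO (to0 v_nat)
    (fun s => K_nat m s - 1 / 2 * m * v_nat s ^ 2)
    (fun s => v_nat s ^ 4)
  /\
  (* the two quadratic readings differ exactly at fourth order *)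
  is_bigTheta (to0 qdot)
    (fun s => 1 / 2 * m * qdot s ^ 2 - 1 / 2 * m * v_nat s ^ 2)
    (fun s => qdot s ^ 4)
  /\
  (* the quartic coefficients of the two expansions of K are different *)
  (exists a : R, a <> m / 24 /\
     is_bigO (to0 v_nat)
       (fun s => K_nat m s - (1 / 2 * m * v_nat s ^ 2 + a * v_nat s ^ 4))
       (fun s => v_nat s ^ 6)).
Proof.
  split; [|split; [|split; [|split; [|split; [|split; [|split]]]]]].
  - intro phi.
    assert (E : v_SR c phi / c = tanh phi) by (unfold v_SR; field; lra).
    rewrite E, <- cosh_lorentz_factor.
    repeat split. apply tanh2_lt_1.
  (* Along the identity, [to0] is the ordinary neighbourhood filter of 0. *)
  - assert (H : is_bigO (to0 (fun phi : R => phi))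
      (fun phi => K m phi - (1 / 2 * m * phi ^ 2 + m / 24 * phi ^ 4)) (fun phi => phi ^ 6)).
    { apply bigO_to0 with (3 * m) 1; [lra|].
      intros phi Hphi. apply K_taylor4; lra. }
    destruct H as [C [d H]]. exists C, d. intros phi Hphi. exact (H phi Hphi phi eq_refl).
  - intro s. split; [apply is_derive_xi|reflexivity].
  - apply bigO_to0 with (4 / 3) (1 / 2); [lra|].
    intro s. rewrite v_natE. apply rapidity_expansion.
  - apply bigO_to0 with (3 * m) 1; [lra|].
    intros s Hs. apply K_taylor4; [exact hm|]. now left.
  - apply bigO_to0 with (2 * m) (1 / 2); [lra|].
    intro s. rewrite v_natE. intros Hs.
    (* The quartic term and its remainder add up to at most (3/8 + 1/4) m t^4, below 2 m t^4. *)
    generalize (K_velocity_expansion m _ hm Hs). fold (K_nat m s).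
    set (t := tanh (rapidity s)) in *. rewrite Rabs_pow4. intros H.
    assert (H4 : 0 <= t ^ 4) by (rewrite <- Rabs_pow4; apply Rabs_pos).
    assert (H2 : t ^ 2 <= 1 / 4) by (rewrite <- pow2_abs; generalize (Rabs_pos t); nra).
    assert (t ^ 6 <= t ^ 4 / 4) by (replace (t ^ 6) with (t ^ 4 * t ^ 2) by ring; nra).
    assert (0 <= m * t ^ 4) by nra.
    assert (m * t ^ 6 <= m * (t ^ 4 / 4)) by nra.
    apply Rabs_le_between. lra.
  (* Both constants of [square_gap_bounds] are multiplied by m/2; the lower one, inverted, gives the
     constant of the reverse estimate. *)
  - assert (G : forall s : state, Rabs (qdot s) < 1 / 2 ->
      9 / 128 * m * qdot s ^ 4
        <= 1 / 2 * m * qdot s ^ 2 - 1 / 2 * m * v_nat s ^ 2 <= m * qdot s ^ 4).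
    { intros s Hs. rewrite v_natE. generalize (square_gap_bounds _ Hs).
      change (rapidity s) with (qdot s). nra. }
    split; [apply bigO_to0 with m (1 / 2)|apply bigO_to0 with (128 / 9 / m) (1 / 2)];
      try lra; intros s Hs; specialize (G s Hs); rewrite Rabs_pow4;
      assert (H4 : 0 <= m * qdot s ^ 4)
        by (rewrite <- Rabs_pow4; apply Rmult_le_pos; [lra|apply Rabs_pos]);
      rewrite Rabs_pos_eq by lra; [lra|].
    apply Rmult_le_reg_l with (9 / 128 * m); [lra|].
    replace (9 / 128 * m * (128 / 9 / m * (1 / 2 * m * qdot s ^ 2 - 1 / 2 * m * v_nat s ^ 2)))
      with (1 / 2 * m * qdot s ^ 2 - 1 / 2 * m * v_nat s ^ 2) by (field; lra).
    lra.
  (* The quartic coefficient of (1 - t^2)^(-1/2), times [m]. *)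
  - exists (3 / 8 * m). split; [lra|].
    apply bigO_to0 with m (1 / 2); [lra|].
    intro s. rewrite v_natE. intros Hs. rewrite Rabs_pow6.
    generalize (K_velocity_expansion m _ hm Hs). unfold K_nat. intros H.
    rewrite Rabs_pos_eq; lra.
Qed.
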